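(* There is an algorithm which, given a connected interval graph $G$ with $n$ vertices and $m$ edges together with an ordering $u_1,\dots,u_n$ of its vertices by increasing left endpoints of the intervals of an interval representation, outputs a minimum paired-dominating set of $G$ in $O(m+n)$ time.
   Context: An interval graph is a graph having an interval representation, i.e. a family of intervals assigned to the vertices such that two vertices are adjacent iff their intervals intersect. For a graph without isolated vertices, a set $S$ of vertices is a paired-dominating set if every vertex not in $S$ is adjacent to a vertex of $S$ and the induced subgraph on $S$ has a perfect matching; a minimum paired-dominating set is one of minimum cardinality. *)

(* Defs.v *)
From mathcomp Require Import all_boot all_order perm interval.
From mathcomp Require Import reals.

Set Implicit Arguments.
Unset Strict Implicit.
Unset Printing Implicit Defensive.

Import Order.TTheory.

Section Graphs.
Variable T : finType.
Implicit Types (e : rel T) (S : {set T}) (M : {set {set T}}).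

Definition simple_graph e : Prop := symmetric e /\ irreflexive e.

Definition edges e : {set {set T}} := [set [set x; y] | x in T, y in T & e x y].

Definition connected_graph e : Prop :=
  0 < #|T| /\ forall x y, connect e x y.

Definition no_isolated_vertex e : Prop := forall x, exists y, e x y.

Definition induced e S : rel T := [rel x y | [&& x \in S, y \in S & e x y]].

Definition dominating e S : Prop :=
  forall x, x \notin S -> exists2 y, y \in S & e x y.

(* [M] is a perfect matching of the graph with vertex set [S] and edges [e]. *)
Definition perfect_matching e S M : Prop := M \subset edges e /\ partition M S.

Definition paired_dominating e S : Prop :=
  dominating e S /\ exists M, perfect_matching (induced e S) S M.

Definition minimum_paired_dominating e S : Prop :=
  paired_dominating e S /\ forall S', paired_dominating e S' -> #|S| <= #|S'|.

(* Intervals may be open, closed, half-open or unbounded. *)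
Definition interval_representation (R : realType) e (J : T -> interval R) : Prop :=
  forall x y, x != y -> e x y <-> exists z : R, z \in J x /\ z \in J y.

End Graphs.

(* [(J x).1] is the left bound of [J x]. Bounds are compared in the order of
   [itv_bound R]: by endpoint value, and at the same value a closed left bound
   precedes an open one. Equal left bounds may come in any order. *)
Definition increasing_left_endpoints (R : realType) (n : nat)
    (J : 'I_n -> interval R) (u : {perm 'I_n}) : Prop :=
  forall i j : 'I_n, i <= j -> ((J (u i)).1 <= (J (u j)).1)%O.

(* Uniform-cost random access machine with structured control: finitely many
   registers and arrays per program, all holding natural numbers. The only
   arithmetic is addition and truncated subtraction, and every operation,
   array access and test costs one unit of time. *)
Inductive expr :=
  | Const of nat
  | Reg of nat
  | Get of nat & expr
  | Add of expr & expr
  | Sub of expr & expr.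

Inductive cmd :=
  | Skip
  | SetReg of nat & expr
  | SetArr of nat & expr & expr
  | Seq of cmd & cmd
  | If of expr & cmd & cmd
  | While of expr & cmd.

Record state := State { reg : nat -> nat; arr : nat -> nat -> nat }.

Fixpoint eval (s : state) (a : expr) : nat :=
  match a with
  | Const k => k
  | Reg r => reg s r
  | Get b i => arr s b (eval s i)
  | Add a1 a2 => eval s a1 + eval s a2
  | Sub a1 a2 => eval s a1 - eval s a2
  end.

Fixpoint ecost (a : expr) : nat :=
  match a with
  | Const _ | Reg _ => 1
  | Get _ i => (ecost i).+1
  | Add a1 a2 | Sub a1 a2 => (ecost a1 + ecost a2).+1
  end.

Definition set_reg (s : state) (r v : nat) : state :=
  State (fun r' => if r' == r then v else reg s r') (arr s).

Definition set_arr (s : state) (b i v : nat) : state :=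
  State (reg s)
        (fun b' i' => if (b' == b) && (i' == i) then v else arr s b' i').

(* [exec p s t s']: started in [s], the program [p] halts in state [s'] after
   exactly [t] units of time. Tests succeed when their value is nonzero. *)
Inductive exec : cmd -> state -> nat -> state -> Prop :=
  | ExecSkip s : exec Skip s 1 s
  | ExecSetReg r a s : exec (SetReg r a) s (ecost a).+1 (set_reg s r (eval s a))
  | ExecSetArr b i a s :
      exec (SetArr b i a) s (ecost i + ecost a).+1
           (set_arr s b (eval s i) (eval s a))
  | ExecSeq p q s t s' t' s'' :
      exec p s t s' -> exec q s' t' s'' -> exec (Seq p q) s (t + t') s''
  | ExecIfTrue a p q s t s' :
      eval s a != 0 -> exec p s t s' -> exec (If a p q) s (ecost a + t).+1 s'
  | ExecIfFalse a p q s t s' :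
      eval s a = 0 -> exec q s t s' -> exec (If a p q) s (ecost a + t).+1 s'
  | ExecWhileFalse a p s :
      eval s a = 0 -> exec (While a p) s (ecost a).+1 s
  | ExecWhileTrue a p s t s' t' s'' :
      eval s a != 0 -> exec p s t s' -> exec (While a p) s' t' s'' ->
      exec (While a p) s (ecost a + t + t').+1 s''.

Lemma exec_det p s t1 s1 t2 s2 :
  exec p s t1 s1 -> exec p s t2 s2 -> t1 = t2 /\ s1 = s2.
Proof.
move=> H; elim: H t2 s2 => {p s t1 s1} *;
  match goal with H : exec _ _ ?t ?s |- _ = ?t /\ _ = ?s => inversion H; subst end;
  repeat match goal with
  | IH : forall t s, exec ?p ?s0 t s -> _, H : exec ?p ?s0 _ _ |- _ =>
      case: (IH _ _ H) => ? ?; subst; clear H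
  | H0 : eval ?s ?a = 0, H1 : is_true (eval ?s ?a != 0) |- _ =>
      by rewrite H0 in H1
  end; by [].
Qed.

Definition adjacency_lists (n : nat) (e : rel 'I_n) (adj : 'I_n -> seq 'I_n) :
    Prop :=
  forall x, uniq (adj x) /\ forall y, (y \in adj x) = e x y.

Section Input.
Variables (n : nat) (e : rel 'I_n) (u : {perm 'I_n}) (adj : 'I_n -> seq 'I_n).

Definition ordering_array : seq nat := [seq val (u i) | i <- enum 'I_n].

(* The neighbours of vertex [x] occupy the cells
   [offset_array`_x, ..., offset_array`_(x + 1) - 1] of [neighbour_array]. *)
Definition offset_array : seq nat :=
  [seq sumn (take k [seq size (adj x) | x <- enum 'I_n]) | k <- iota 0 n.+1].

Definition neighbour_array : seq nat :=
  [seq val y | y <- flatten [seq adj x | x <- enum 'I_n]].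

Definition input : state :=
  State (nth 0 [:: n; #|edges e|])
        (fun b => nth 0 (nth [::] [:: ordering_array; offset_array;
                                      neighbour_array] b)).

End Input.

(* The output is a list: its length is in register 0, its items in array 3. *)
Definition output (s : state) : seq nat := mkseq (arr s 3) (reg s 0).

(* Main.v *)
(** Number the vertices by left endpoint. A vertex [i] is adjacent to exactly the
later vertices up to its reach [R i]; let [F j] be the first vertex of the closed
neighbourhood of [j]. Scan [j] from right to left with a threshold [a] such that
the undominated vertices are those with [R j < a]. When the scan meets such a [j],
it selects [b = max (F j) 1] and [F b], and the threshold becomes [F b]. The pair
is an edge, everything it fails to dominate has reach below [F b], and so all later
selected vertices lie below [F b]: the pairs are disjoint. Conversely an edge
dominating [j] has both ends at or after [F b], so it dominates no later witness:
a paired-dominating set needs one matching edge per witness. Computing [F] and [R]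
reads every adjacency list once, which gives linear time. *)

Require Import Defs.
From mathcomp Require Import all_boot all_order perm interval.
From mathcomp Require Import reals.
From mathcomp Require Import zify.

Set Implicit Arguments.
Unset Strict Implicit.
Unset Printing Implicit Defensive.

Import Order.TTheory.

(** * The greedy scan on positions, as pure arithmetic of [F] and [R] *)

Section Greedy.
Variables (n : nat) (F R : nat -> nat).

(** Closed adjacency of positions expressed through reaches alone; [touchE] identifies it with the
    graph relation. *)
Definition touch i j := (i <= j <= R i) || (j <= i <= R j).

(* Triples of a witness [j] and the pair [F b < b] selected for it. The [max] with
   1 only matters when [F j = 0]; the pair is then [0, 1]. *)
Fixpoint greedy (k a : nat) : seq (nat * nat * nat) :=
  if k is j.+1 then
    if R j < a then
      let b := maxn (F j) 1 in (j, F b, b) :: greedy j (F b)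
    else greedy j a
  else [::].

Definition chosen (l : seq (nat * nat * nat)) : seq nat :=
  flatten [seq [:: p.1.2; p.2] | p <- l].

Lemma greedy_witness_lt k a (p : nat * nat * nat) :
  p \in greedy k a -> p.1.1 < k.
Proof.
elim: k a => [//|k IH] a /=; case: ifP => _.
  by rewrite inE => /orP[/eqP -> //|/IH]; lia.
by move=> /IH; lia.
Qed.

Lemma greedy_witness_uniq k a : uniq [seq p.1.1 | p <- greedy k a].
Proof.
elim: k a => [//|k IH] a /=; case: ifP => _ //=; rewrite IH andbT.
by apply/negP => /mapP [p /greedy_witness_lt lt_pk E]; rewrite -E ltnn in lt_pk.
Qed.

Lemma touch_sym x y : touch x y = touch y x.
Proof. by rewrite /touch orbC. Qed.

Hypothesis n_gt1 : 1 < n.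
Hypothesis R_bound : forall i, i < n -> i <= R i < n.
Hypothesis F_bound : forall j, j < n -> F j <= j <= R (F j).
Hypothesis F_min : forall i j, i <= j -> j < n -> j <= R i -> F j <= i.
Hypothesis F_lt : forall j, 0 < j -> j < n -> F j < j.

Lemma F1 : F 1 = 0.
Proof. by have := F_lt (isT : 0 < 1) n_gt1; lia. Qed.

Lemma R0_gt0 : 0 < R 0.
Proof. by have := F_bound n_gt1; rewrite F1; lia. Qed.

(** If [F j <= i], then [F j] reaches past [i] up to [j], so it competes for [F i]; otherwise
    [F i <= i < F j]. *)
Lemma F_mono i j : i <= j -> j < n -> F i <= F j.
Proof.
move=> le_ij lt_jn; have := F_bound lt_jn => /andP[Fj jR].
case: (leqP (F j) i) => [le_Fi|lt_iF]; first by apply: F_min; lia.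
by have := @F_bound i; lia.
Qed.

(** Both [F j] and 1 are at most [R j]; for [j = 0] the latter is [R0_gt0]. *)
Lemma partner_le j a : j < n -> R j < a -> maxn (F j) 1 < a.
Proof.
move=> lt_jn lt_Ra; have := F_bound lt_jn; have := R_bound lt_jn.
by case: j lt_jn lt_Ra => [|j] *; have := R0_gt0; lia.
Qed.

Lemma partner_lt_n j : j < n -> maxn (F j) 1 < n.
Proof. by move=> lt_jn; have := F_bound lt_jn; lia. Qed.

Lemma greedy_pair k a (p : nat * nat * nat) : k <= n -> p \in greedy k a ->
  [/\ p.1.1 < k, R p.1.1 < a, p.1.2 < p.2, p.2 < n & p.2 <= R p.1.2]
  /\ p.2 = maxn (F p.1.1) 1.
Proof.
elim: k a => [//|k IH] a lt_kn /=; case: ifP => [lt_Ra|_]; last first.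
  by move=> /(IH _ (ltnW lt_kn)) [[? ? ? ? ?] ?]; split=> //; split=> //; lia.
have b_lt := partner_lt_n lt_kn; have b_lta := partner_le lt_kn lt_Ra.
(* With [b] the new partner, [F b < b < a]: this orders the pair and lets bounds by the new
   threshold [F b] weaken to bounds by [a]. *)
have a_lt : F (maxn (F k) 1) < maxn (F k) 1 by apply: F_lt => //; lia.
rewrite inE => /orP[/eqP -> /=|].
  by split=> //; split=> //; have := F_bound b_lt; lia.
by move=> /(IH _ (ltnW lt_kn)) [[? ? ? ? ?] ?]; split=> //; split=> //; lia.
Qed.

Lemma greedy_pair_lt k a (p : nat * nat * nat) : k <= n -> p \in greedy k a -> p.2 < a.
Proof.
move=> le_kn /(greedy_pair le_kn) [[? ?]] *.
have /partner_le : p.1.1 < n by lia.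
by move=> /(_ a); lia.
Qed.

(** By [greedy_pair_lt] the tail selects only positions below its threshold [F b], and [F b < b]. *)
Lemma greedy_uniq k a : k <= n -> uniq (chosen (greedy k a)).
Proof.
elim: k a => [//|k IH] a lt_kn /=; have le_kn := ltnW lt_kn.
case: ifP => [lt_Ra|_]; last exact: IH.
have b_lt := partner_lt_n lt_kn.
have a_lt : F (maxn (F k) 1) < maxn (F k) 1 by apply: F_lt => //; lia.
rewrite /chosen /= -/(chosen _) (IH _ le_kn) andbT inE negb_or.
have small x : x \in chosen (greedy k (F (maxn (F k) 1))) ->
    x < F (maxn (F k) 1).
  case/flatten_mapP=> p pin; have := greedy_pair_lt le_kn pin.
  by have [[? ? ? ? ?] _] := greedy_pair le_kn pin; rewrite !inE; lia.
apply/andP; split; [apply/andP; split|]; first by lia.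
  by apply/negP => /small; lia.
by apply/negP => /small; lia.
Qed.

Lemma greedy_dominates k a i : k <= n -> i < k -> R i < a ->
  exists2 x, x \in chosen (greedy k a) & touch i x.
Proof.
elim: k a => [//|k IH] a lt_kn lt_ik lt_Ra /=; have le_kn := ltnW lt_kn.
case: ifP => [lt_Rk|/negbT lt_Rk]; last first.
  by apply: IH => //; case: (ltngtP i k) => // eq_ik; [lia | subst; lia].
set b := maxn _ _.
have b_lt : b < n := partner_lt_n lt_kn.
have a_lt : F b < b by apply: F_lt => //; lia.
have := F_bound b_lt; have := F_bound lt_kn.
rewrite /chosen /= -/(chosen _) => Fk Fb.
(* Positions with reach below the new threshold are left to the rest of the scan; all others must
   touch [F b] or [b]. *)
case: (ltnP (R i) (F b)) => [lt_RF|le_FR].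
  have lt_in : i < n by lia.
  have Ri := R_bound lt_in.
  have [|x xin tx] := IH (F b) le_kn _ lt_RF; last first.
    by exists x => //; rewrite !inE xin !orbT.
  (* [i < k] follows from [i <= R i < F b < b]; the case [k = 0] is impossible, since then
     [F b = 0]. *)
  have : b <= maxn k 1 by lia.
  by case: (k) lt_ik Fk => [|k'] *; lia.
(* A position up to [b] either lies between [F b] and [b], within the reach of [F b], or lies below
   [F b] and reaches it. *)
case: (leqP i b) => [le_ib|lt_bi].
  by exists (F b); [rewrite inE eqxx | rewrite /touch; lia].
(* Beyond [b], the position [i <= k] is within the reach of [F k], which is [F b = 0] when the max
   gives 1, and [b] otherwise. *)
have [b1|bF] : b = 1 /\ F k = 0 \/ b = F k by lia.
  exists (F b); first by rewrite inE eqxx.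
  case: b1 => b1 Fk0; rewrite b1 F1 /touch; move: Fk; rewrite Fk0; lia.
by exists b; [rewrite !inE eqxx orbT | rewrite /touch -bF in Fk *; lia].
Qed.

Lemma touch_ge j x : j < n -> touch j x -> F j <= x.
Proof.
move=> lt_jn; have := F_bound lt_jn => Fj.
case: (leqP x j) => [le_xj|]; last by lia.
rewrite /touch => /orP[|/andP[_ le_jR]]; first by lia.
exact: F_min.
Qed.

(** By monotonicity [y >= F x >= F (F j)], and [x >= F j >= F (F j)]. If the max is 1, the bound is
    [F 1 = 0]. *)
Lemma greedy_edge_ge j x y : j < n -> x < n -> y < n ->
  touch j x -> touch x y -> F (maxn (F j) 1) <= minn x y.
Proof.
move=> ltj ltx lty /(touch_ge ltj) le_Fx /(touch_ge ltx) le_Fy.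
have [->|->] : maxn (F j) 1 = 1 \/ maxn (F j) 1 = F j by lia.
  by rewrite F1; lia.
have := F_mono le_Fx ltx; have := @F_bound (F j); have := F_bound ltj; lia.
Qed.

(** A later witness [r] satisfies [r <= R r < F b], while an edge touching the current witness has
    both ends at or after [F b]; so no edge serves both. *)
Lemma greedy_packing k a (p q : nat * nat * nat) x y : k <= n ->
    p \in greedy k a -> q \in greedy k a -> x < n -> y < n -> touch x y ->
    touch p.1.1 x || touch p.1.1 y -> touch q.1.1 x || touch q.1.1 y ->
  p.1.1 = q.1.1.
Proof.
move=> + + + ltx lty txy; elim: k a => [//|k IH] a lt_kn /=.
have le_kn := ltnW lt_kn; case: ifP => [lt_Rk|_]; last exact: IH.
have key (r : nat * nat * nat) : r \in greedy k (F (maxn (F k) 1)) ->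
    touch k x || touch k y -> touch r.1.1 x || touch r.1.1 y -> False.
  move=> /(greedy_pair le_kn) [[ltr Rr _ _ _] _] tk.
  have le_min : F (maxn (F k) 1) <= minn x y.
    case/orP: tk => tk; first exact: greedy_edge_ge.
    by rewrite minnC; apply: greedy_edge_ge; rewrite // touch_sym.
  have := @R_bound r.1.1; rewrite /touch; lia.
rewrite !inE => /orP[/eqP->|pin] /orP[/eqP->|qin] //= tp tq.
- by case: (key _ qin tp tq).
- by case: (key _ pin tq tp).
- exact: (IH _ le_kn pin qin).
Qed.

End Greedy.

(** * Edges, perfect matchings and the degree sum *)

Lemma edgesP (T : finType) (e : rel T) (B : {set T}) :
  reflect (exists x y, e x y /\ B = [set x; y]) (B \in edges e).
Proof.
apply: (iffP imset2P) => [[x y _]|[x [y [exy ->]]]].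
  by rewrite !inE => exy ->; exists x, y.
by exists x y => //; rewrite inE.
Qed.

Section Matching.
Variables (T : finType) (e : rel T).
Hypothesis e_simple : simple_graph e.

Lemma edge_card B : B \in edges e -> #|B| = 2.
Proof.
move=> /edgesP [x [y [exy ->]]]; rewrite cards2.
by case: eqP exy => // ->; rewrite (proj2 e_simple).
Qed.

Lemma card_perfect_matching S M :
  perfect_matching (induced e S) S M -> #|S| = #|M| * 2.
Proof.
move=> [sub part]; apply: card_uniform_partition part => B /(subsetP sub).
move=> /edgesP [x [y [/and3P[_ _ exy] ->]]].
by apply: edge_card; apply/edgesP; exists x, y.
Qed.

(** Turns a duplicate-free list of adjacent pairs into a matching. Blocks are added one at a time,
    and absence of duplicates keeps each new block disjoint from the others. *)
Lemma perfect_matching_pairs (ps : seq (T * T)) (S : {set T}) :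
    S =i flatten [seq [:: p.1; p.2] | p <- ps] ->
    uniq (flatten [seq [:: p.1; p.2] | p <- ps]) ->
    {in ps, forall p, e p.1 p.2} ->
  perfect_matching (induced e S) S [set:: [seq [set p.1; p.2] | p <- ps]].
Proof.
move=> eqS Ups edge_ps; split.
  apply/subsetP => B; rewrite inE => /mapP [p pin ->].
  apply/edgesP; exists p.1, p.2; split=> //.
  apply/and3P; split; last exact: edge_ps.
    by rewrite eqS; apply/flatten_mapP; exists p; rewrite // !inE eqxx.
  by rewrite eqS; apply/flatten_mapP; exists p; rewrite // !inE eqxx orbT.
elim: ps S eqS Ups {edge_ps} => [|p ps IH] S eqS Ups.
  have -> : S = set0 by apply/setP => x; rewrite eqS !inE.
  have -> : [set:: [seq [set p.1; p.2] | p : T * T <- [::]]] = set0.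
    by apply/setP => B; rewrite !inE.
  by rewrite partition_set0.
move: Ups => /= /and3P[]; rewrite inE negb_or => /andP[_ p1N] p2N Ups.
have -> : [set:: [seq [set p.1; p.2] | p <- p :: ps]] =
    [set p.1; p.2] |: [set:: [seq [set p.1; p.2] | p <- ps]].
  by apply/setP => B; rewrite !inE.
pose S0 := [set x in flatten [seq [:: p.1; p.2] | p <- ps]].
have -> : S = [set p.1; p.2] :|: S0.
  by apply/setP => x; rewrite eqS !inE orbA.
apply: partitionU1.
- by apply: IH => // x; rewrite inE.
- by apply/set0Pn; exists p.1; rewrite !inE eqxx.
rewrite disjoints_subset; apply/subsetP => x; rewrite !inE.
by case/orP => /eqP ->.
Qed.

(** Double counting of incidences: the neighbours [y] of [x] correspond bijectively to the edges
    [[set x; y]], as there are no loops, and each edge has two ends. *)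
Lemma sum_degree_le (adj : T -> seq T) :
    (forall x, uniq (adj x) /\ forall y, (y \in adj x) = e x y) ->
  \sum_x size (adj x) <= 2 * #|edges e|.
Proof.
move=> adjP.
have -> : \sum_x size (adj x) = \sum_x \sum_(B in edges e) (x \in B : nat).
  apply: eq_bigr => x _; have [Ux adjx] := adjP x.
  rewrite -(card_uniqP Ux) -big_mkcondr sum1_card /=.
  have inj : {in adj x &, injective (fun y => [set x; y])}.
    move=> y z; rewrite !adjx => exy exz /setP /(_ y).
    rewrite !inE eqxx orbT => /esym /orP[/eqP yx|/eqP //].
    by move: exy; rewrite yx (proj2 e_simple).
  rewrite -(card_in_imset inj); apply: eq_card => B.
  rewrite unfold_in; apply/imsetP/andP => [[y]|[/edgesP [a [b [eab ->]]]]].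
    rewrite adjx => exy ->; rewrite !inE eqxx; split=> //.
    by apply/edgesP; exists x, y; split.
  rewrite !inE => /orP[] /eqP E; subst x; first by exists b; rewrite ?adjx.
  by exists a; [rewrite adjx (proj1 e_simple) | rewrite setUC].
rewrite exchange_big /= [2 * _]mulnC -(sum_nat_const (mem (edges e))).
apply: leq_sum => B Bin; rewrite -(edge_card Bin) -sum1_card.
by rewrite [X in _ <= X]big_mkcond; apply: leq_sum => x _; case: (x \in B).
Qed.

End Matching.

Lemma card_ord_mem n (l : seq nat) :
  uniq l -> {in l, forall x, x < n} -> #|[set i : 'I_n | val i \in l]| = size l.
Proof.
move=> Ul lt_l; rewrite cardE -(size_map val).
apply/perm_size/uniq_perm => //.
  by rewrite map_inj_uniq ?enum_uniq //; apply: val_inj.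
move=> x; apply/mapP/idP => [[i]|xl]; first by rewrite mem_enum inE => ? ->.
by exists (Ordinal (lt_l _ xl)); rewrite // mem_enum inE.
Qed.

(** * Transfer from positions to the graph *)

Section LeftOrdered.
Variables (n : nat) (e : rel 'I_n) (u : {perm 'I_n}) (F R : nat -> nat).

Definition nbr_eq (i j : 'I_n) := (i == j) || e (u i) (u j).

Hypothesis e_simple : simple_graph e.
Hypothesis e_connected : connected_graph e.
Hypothesis e_no_isolated : no_isolated_vertex e.
Hypothesis umbrella :
  forall i j k : 'I_n, i < j -> j < k -> e (u i) (u k) -> e (u i) (u j).
Hypothesis F_le : forall i j, nbr_eq i j -> F i <= j.
Hypothesis F_ex : forall i : 'I_n, exists2 j : 'I_n, nbr_eq i j & F i = j.
Hypothesis R_ge : forall i j : 'I_n, nbr_eq i j -> j <= R i.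
Hypothesis R_ex : forall i : 'I_n, exists2 j : 'I_n, nbr_eq i j & R i = j.

Lemma nbr_eqC i j : nbr_eq i j = nbr_eq j i.
Proof. by rewrite /nbr_eq eq_sym (proj1 e_simple). Qed.

(** The umbrella property makes the later neighbours of [i] fill the whole segment up to [R i]. *)
Lemma nbr_eq_le (i j : 'I_n) : i <= j -> nbr_eq i j = (j <= R i).
Proof.
move=> le_ij; apply/idP/idP => [/R_ge //|le_jR].
have [k ik Rk] := R_ex i; rewrite Rk in le_jR.
have [ij|ij] := eqVneq i j; first by rewrite ij /nbr_eq eqxx.
have [jk|jk] := eqVneq j k; first by rewrite jk.
have neq_ij : (i : nat) != j by [].
have neq_jk : (j : nat) != k by [].
move: ik; rewrite /nbr_eq => /orP[/eqP ik|eik]; first by subst k; lia.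
by rewrite (@umbrella i j k) ?orbT //; lia.
Qed.

Lemma touchE (i j : 'I_n) : touch R i j = nbr_eq i j.
Proof.
rewrite /touch; case: (leqP i j) => [le_ij|lt_ji].
  rewrite (nbr_eq_le le_ij) /=; case: leqP => //= lt_Rj.
  apply/negP => /andP[le_ji _]; have E : i = j by apply: val_inj => /=; lia.
  by have := @R_ge i j; rewrite /nbr_eq E eqxx => /(_ isT); rewrite -E in lt_Rj *; lia.
by rewrite nbr_eqC nbr_eq_le /=; lia.
Qed.

Lemma reach_bound i : i < n -> i <= R i < n.
Proof.
move=> lt_in; have [j _ Rj] := R_ex (Ordinal lt_in).
have := @R_ge (Ordinal lt_in) (Ordinal lt_in); rewrite /nbr_eq eqxx => /(_ isT).
by move: Rj => /= -> /=; have := ltn_ord j; lia.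
Qed.

Lemma first_bound j : j < n -> F j <= j <= R (F j).
Proof.
move=> lt_jn; set o := Ordinal lt_jn; have [i oi Fi] := F_ex o.
have oo : nbr_eq o o by rewrite /nbr_eq eqxx.
rewrite -[j]/(val o) (F_le oo) Fi /=.
by apply: (@R_ge i o); rewrite nbr_eqC.
Qed.

Lemma first_min i j : i <= j -> j < n -> j <= R i -> F j <= i.
Proof.
move=> le_ij lt_jn le_jR; have lt_in : i < n by lia.
apply: (@F_le (Ordinal lt_jn) (Ordinal lt_in)).
by rewrite nbr_eqC nbr_eq_le.
Qed.

(** This is where connectivity enters. An edge from a position before [j] to one at or after [j]
    would make its first end a neighbour of [j]; without such a neighbour the positions before [j]
    form a union of components. *)
Lemma first_lt j : 0 < j -> j < n -> F j < j.
Proof.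
move=> j_gt0 lt_jn; set o := Ordinal lt_jn.
have n_gt0 : 0 < n by lia.
case: (ltnP (F j) j) => // le_jF.
pose A : {pred 'I_n} := [pred x | (u^-1%g x : 'I_n) < j].
have sym_e : connect_sym e := sym_connect_sym (proj1 e_simple).
have clA : closed e A.
  apply: intro_closed => // x y exy; rewrite !inE => xA.
  case: ltnP => // yA; have : nbr_eq o (u^-1%g x).
    rewrite nbr_eqC nbr_eq_le /=; last by lia.
    have : nbr_eq (u^-1%g x) (u^-1%g y) by rewrite /nbr_eq !permKV exy orbT.
    by move/R_ge; lia.
  by move/F_le => /=; lia.
have := closed_connect clA (proj2 e_connected (u (Ordinal n_gt0)) (u o)).
by rewrite !inE !permK /= j_gt0 ltnn.
Qed.

Lemma order_gt1 : 1 < n.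
Proof.
have [n_gt0 _] := e_connected; rewrite card_ord in n_gt0.
have [y] := e_no_isolated (Ordinal n_gt0).
have [->|] := eqVneq y (Ordinal n_gt0); first by rewrite (proj2 e_simple).
rewrite -val_eqE /=; have := ltn_ord y; lia.
Qed.

Let greedy_list := greedy F R n n.

Lemma chosen_lt x : x \in chosen greedy_list -> x < n.
Proof.
case/flatten_mapP => p pin.
have [[] ] := greedy_pair order_gt1 reach_bound first_bound first_lt (leqnn n) pin.
by rewrite !inE => ? ? ? ? ? ? /orP[]/eqP ->; lia.
Qed.

(** Domination sends each witness to a block of [M] meeting its closed neighbourhood. By
    [greedy_packing] this map is injective on witnesses, and each block has two vertices. *)
Lemma paired_dominating_ge (S : {set 'I_n}) :
  paired_dominating e S -> 2 * size greedy_list <= #|S|.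
Proof.
move=> [dom [M MP]]; rewrite (card_perfect_matching e_simple MP) mulnC leq_mul2r /=.
have [sub part] := MP.
pose hit (j : 'I_n) (B : {set 'I_n}) := [exists x in B, nbr_eq j (u^-1%g x)].
have hitP j : exists2 B, B \in M & hit j B.
  have [x xS jx] : exists2 x, x \in S & nbr_eq j (u^-1%g x).
    have [uS|/dom [x xS ux]] := boolP (u j \in S).
      by exists (u j); rewrite // permK /nbr_eq eqxx.
    by exists x; rewrite // /nbr_eq permKV ux orbT.
  move: (xS); rewrite -(cover_partition part) => /bigcupP [B BM xB].
  by exists B => //; apply/existsP; exists x; rewrite xB.
have [f fP] : exists f : 'I_n -> {set 'I_n}, forall j, f j \in M /\ hit j (f j).
  apply: (fin_all_exists (P := fun j B => B \in M /\ hit j B)) => j.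
  by have [B] := hitP j; exists B.
pose W := [set j : 'I_n | val j \in [seq p.1.1 | p <- greedy_list]].
have sizeW : size greedy_list = #|W|.
  rewrite card_ord_mem ?size_map ?greedy_witness_uniq // => _ /mapP [p pin ->].
  exact: greedy_witness_lt pin.
rewrite sizeW -(card_in_imset (f := f)).
  by apply/subset_leq_card/subsetP => B /imsetP [j _ ->]; case: (fP j).
move=> j k; rewrite !inE => /mapP [p pin jp] /mapP [q qin kq] fjk.
apply: val_inj; rewrite jp kq.
have [fM hj] := fP j; have [_ hk] := fP k; rewrite -fjk in hk.
have /edgesP [x [y [/and3P[_ _ exy] fE]]] := subsetP sub _ fM.
have hitE (i : 'I_n) : hit i (f j) ->
    touch R i (u^-1%g x : 'I_n) || touch R i (u^-1%g y : 'I_n).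
  rewrite !touchE fE => /existsP [z]; rewrite !inE => /andP[/orP[] /eqP ->] -> //.
  by rewrite orbT.
apply: (greedy_packing order_gt1 reach_bound first_bound first_min first_lt
          (leqnn n) pin qin (ltn_ord (u^-1%g x)) (ltn_ord (u^-1%g y))).
- by rewrite touchE /nbr_eq !permKV exy orbT.
- by rewrite -jp; apply: hitE.
- by rewrite -kq; apply: hitE.
Qed.

(** Domination is [greedy_dominates] with initial threshold [n], which exceeds every reach; the
    selected pairs themselves form the matching. *)
Lemma greedy_minimum (S : {set 'I_n}) :
    (forall i : 'I_n, (u i \in S) = (val i \in chosen greedy_list)) ->
  minimum_paired_dominating e S.
Proof.
move=> SE.
have Uc := greedy_uniq order_gt1 reach_bound first_bound first_lt n (leqnn n).
have size_chosen l : size (chosen l) = 2 * size l.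
  by elim: l => [//|p l IH] /=; rewrite mulnS -IH.
have cardS : #|S| = 2 * size greedy_list.
  rewrite -size_chosen -(card_ord_mem Uc chosen_lt).
  rewrite -[RHS](card_imset _ (@perm_inj _ u)).
  congr #|pred_of_set _|; apply/setP => x; rewrite -[x](permKV u) SE.
  by rewrite mem_imset ?inE //; apply: perm_inj.
split; last by move=> S' /paired_dominating_ge; rewrite cardS.
split.
  move=> x xS; have lt_x := ltn_ord (u^-1%g x).
  have [y yc] : exists2 y, y \in chosen greedy_list & touch R (u^-1%g x : 'I_n) y.
    apply: (@greedy_dominates n) => //; first exact: order_gt1.
    - exact: reach_bound.
    - exact: first_bound.
    - exact: first_lt.
    by case/andP: (reach_bound lt_x).
  have lt_yn := chosen_lt yc; rewrite -[y]/(val (Ordinal lt_yn)) touchE.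
  have yS : u (Ordinal lt_yn) \in S by rewrite SE.
  rewrite /nbr_eq permKV => /orP[/eqP xy|exy]; last by exists (u (Ordinal lt_yn)).
  by rewrite -xy permKV (negbTE xS) in yS.
(* The default position 0 is used only outside the range, and [chosen_lt] keeps chosen positions
   inside it. *)
pose vertex k := u (insubd (Ordinal (ltnW order_gt1)) k).
have vertexE k (lt_kn : k < n) : vertex k = u (Ordinal lt_kn).
  by congr (u _); apply: val_inj; rewrite val_insubd lt_kn.
pose ps := [seq (vertex p.1.2, vertex p.2) | p <- greedy_list].
have psE : flatten [seq [:: p.1; p.2] | p <- ps] = map vertex (chosen greedy_list).
  by rewrite map_flatten -!map_comp.
eexists; apply: (perfect_matching_pairs (ps := ps)); rewrite ?psE.
- move=> x; rewrite -[x](permKV u) SE; apply/idP/mapP => [xc|[k kc]].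
    exists (val (u^-1%g x)); rewrite // (vertexE _ (ltn_ord _)).
    by congr (u _); apply: val_inj.
  by rewrite (vertexE _ (chosen_lt kc)) => /perm_inj ->.
- rewrite map_inj_in_uniq // => k l /chosen_lt ltk /chosen_lt ltl.
  by rewrite (vertexE _ ltk) (vertexE _ ltl) => /perm_inj [].
move=> _ /mapP [p pin ->] /=.
have [[_ _ lt_ab lt_bn le_bR] _] :=
  greedy_pair order_gt1 reach_bound first_bound first_lt (leqnn n) pin.
have lt_an := ltn_trans lt_ab lt_bn; rewrite (vertexE _ lt_an) (vertexE _ lt_bn).
have : nbr_eq (Ordinal lt_an) (Ordinal lt_bn) by rewrite nbr_eq_le // ltnW.
by rewrite /nbr_eq -val_eqE /= (ltn_eqF lt_ab).
Qed.

End LeftOrdered.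

(** * Total correctness with a time budget *)

Definition runs (p : cmd) (s : state) (t : nat) (Q : state -> Prop) : Prop :=
  exists t' s', [/\ exec p s t' s', t' <= t & Q s'].

Section RunsRules.
Implicit Types (p q : cmd) (s : state) (t : nat) (Q : state -> Prop).

Lemma runs_skip s t Q : 0 < t -> Q s -> runs Skip s t Q.
Proof. by move=> t_gt0 Qs; exists 1, s; split=> //; apply: ExecSkip. Qed.

Lemma runs_set_reg r a s t Q :
  ecost a < t -> Q (set_reg s r (eval s a)) -> runs (SetReg r a) s t Q.
Proof. by move=> le_t Qs; do 2!eexists; split; first exact: ExecSetReg. Qed.

Lemma runs_set_arr b i a s t Q :
    ecost i + ecost a < t -> Q (set_arr s b (eval s i) (eval s a)) ->
  runs (SetArr b i a) s t Q.
Proof. by move=> le_t Qs; do 2!eexists; split; first exact: ExecSetArr. Qed.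

Lemma runs_seq t1 t2 p q s t Q :
    t1 + t2 <= t -> runs p s t1 (fun s' => runs q s' t2 Q) ->
  runs (Seq p q) s t Q.
Proof.
move=> le_t [t1' [s1 [ex1 le1 [t2' [s2 [ex2 le2 Q2]]]]]].
exists (t1' + t2'), s2; split=> //; first exact: ExecSeq ex1 ex2.
exact: leq_trans (leq_add le1 le2) le_t.
Qed.

(** Since time is only bounded from above, both branches can share the budget [t1]. *)
Lemma runs_if t1 a p q s t Q :
    ecost a + t1 < t -> (eval s a != 0 -> runs p s t1 Q) ->
    (eval s a = 0 -> runs q s t1 Q) ->
  runs (If a p q) s t Q.
Proof.
move=> le_t run_p run_q; case: (eqVneq (eval s a) 0) => [a0|a1].
  have [t' [s' [ex le' Q']]] := run_q a0.
  by exists (ecost a + t').+1, s'; split=> //; [exact: ExecIfFalse | lia].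
have [t' [s' [ex le' Q']]] := run_p a1.
by exists (ecost a + t').+1, s'; split=> //; [exact: ExecIfTrue | lia].
Qed.

Lemma runs_weaken t1 p s t Q Q1 :
  t1 <= t -> (forall s', Q1 s' -> Q s') -> runs p s t1 Q1 -> runs p s t Q.
Proof.
move=> le_t QQ [t' [s' [ex le' Q']]]; exists t', s'; split=> //; last exact: QQ.
exact: leq_trans le_t.
Qed.

(** The body runs after the decrement, so it sees the indices from [k - 1] down to 0. *)
Definition countdown (r : nat) (p : cmd) : cmd :=
  While (Reg r) (Seq (SetReg r (Defs.Sub (Reg r) (Const 1))) p).

(** Each round costs 6 beyond its body, 2 for the test and 4 for the decrement; the final failing
    test costs 2. *)
Lemma runs_countdown (I : nat -> state -> Prop) (c : nat -> nat) r p k s :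
    (forall i s', I i s' -> reg s' r = i) ->
    (forall i s', i < k -> I i.+1 s' -> runs p (set_reg s' r i) (c i) (I i)) ->
    I k s ->
  runs (countdown r p) s (\sum_(i < k) (c i + 6) + 2) (I 0).
Proof.
move=> regI step; elim: k s step => [|k IH] s step Is.
  exists 2, s; split=> //; last exact: leq_addl.
  by apply: (ExecWhileFalse (a := Reg r)); apply: regI Is.
have [|t1 [s1 [ex1 le1 I1]]] := step k s _ Is; first exact: ltnSn.
have [|t2 [s2 [ex2 le2 I2]]] := IH s1 _ I1.
  by move=> i s' lt_ik; apply: step; apply: ltnW.
have reg_s := regI _ _ Is.
exists (1 + (4 + t1) + t2).+1, s2; split=> //; last first.
  have -> : \sum_(i < k.+1) (c i + 6) = \sum_(i < k) (c i + 6) + (c k + 6).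
    by rewrite big_ord_recr.
  lia.
apply: (ExecWhileTrue (a := Reg r)) ex2; first by rewrite /= reg_s.
apply: (ExecSeq (t := 4)) ex1.
by have := ExecSetReg r (Defs.Sub (Reg r) (Const 1)) s; rewrite /= reg_s subn1.
Qed.

End RunsRules.

(* Arrays 0, 1 and 2 are the input; 3 is the output; 4 holds the position of
   each vertex in the given order; 5 and 6 hold the least and the greatest
   position in its closed neighbourhood. *)
Definition rank_body : cmd := SetArr 4 (Get 0 (Reg 2)) (Reg 2).

(** Under truncated subtraction [a - (a - b)] is a minimum and [a + (b - a)] a maximum. Register 2
    is the current vertex, register 3 an index in its list. *)
Definition scan_body : cmd :=
  Seq (SetReg 5 (Get 4 (Get 2 (Add (Get 1 (Reg 2)) (Reg 3)))))
 (Seq (SetArr 5 (Reg 2) (Defs.Sub (Get 5 (Reg 2)) (Defs.Sub (Get 5 (Reg 2)) (Reg 5))))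
      (SetArr 6 (Reg 2) (Add (Get 6 (Reg 2)) (Defs.Sub (Reg 5) (Get 6 (Reg 2)))))).

(** Both extremes start at the vertex's own position because the neighbourhood is closed. *)
Definition reach_body : cmd :=
  Seq (SetArr 5 (Reg 2) (Get 4 (Reg 2)))
 (Seq (SetArr 6 (Reg 2) (Get 4 (Reg 2)))
 (Seq (SetReg 3 (Defs.Sub (Get 1 (Add (Reg 2) (Const 1))) (Get 1 (Reg 2))))
      (countdown 3 scan_body))).

(** Register 4 is the threshold [a], register 5 becomes [F j] and then [b], and register 0 is the
    output length. Arrays 5 and 6 are indexed by vertices, so positions are first translated through
    array 0. *)
Definition select_body : cmd :=
  If (Defs.Sub (Reg 4) (Get 6 (Get 0 (Reg 2))))
    (Seq (SetReg 5 (Get 5 (Get 0 (Reg 2))))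
    (Seq (SetReg 5 (Add (Reg 5) (Defs.Sub (Const 1) (Reg 5))))
    (Seq (SetReg 4 (Get 5 (Get 0 (Reg 5))))
    (Seq (SetArr 3 (Reg 0) (Get 0 (Reg 4)))
    (Seq (SetArr 3 (Add (Reg 0) (Const 1)) (Get 0 (Reg 5)))
         (SetReg 0 (Add (Reg 0) (Const 2))))))))
    Skip.

(** Register 0 holds [n] on entry and the output length at the end, so [n] is copied as counter and
    as initial threshold before it is cleared. *)
Definition greedy_program : cmd :=
  Seq (SetReg 2 (Reg 0))
 (Seq (countdown 2 rank_body)
 (Seq (SetReg 2 (Reg 0))
 (Seq (countdown 2 reach_body)
 (Seq (SetReg 2 (Reg 0))
 (Seq (SetReg 4 (Reg 0))
 (Seq (SetReg 0 (Const 0))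
      (countdown 2 select_body))))))).

Lemma nth_map_ord n (A : Type) (x0 : A) (f : 'I_n -> A) (i : 'I_n) :
  nth x0 [seq f j | j <- enum 'I_n] i = f i.
Proof. by rewrite (nth_map i) ?size_enum_ord // nth_ord_enum. Qed.

(** * Correctness and running time of the three loops *)

Section Program.
Variables (n : nat) (e : rel 'I_n) (u : {perm 'I_n}) (adj : 'I_n -> seq 'I_n).

Let s0 := input e u adj.
Let pos (x : 'I_n) : nat := (u^-1%g x : 'I_n).

(** A right fold matches the countdown, which reads the list from its end: at counter [k] it has
    folded [drop k]. *)
Definition low_of (s : seq 'I_n) x := foldr (fun y => minn (pos y)) (pos x) s.
Definition high_of (s : seq 'I_n) x := foldr (fun y => maxn (pos y)) (pos x) s.
(** Reindexed by position, as the greedy scan expects, whereas array 5 is indexed by vertex. *)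
Definition low_at := nth 0 [seq low_of (adj (u i)) (u i) | i <- enum 'I_n].
Definition high_at := nth 0 [seq high_of (adj (u i)) (u i) | i <- enum 'I_n].
Definition vertex_at := nth 0 (ordering_array u).

Lemma vertex_atE (i : 'I_n) : vertex_at i = u i.
Proof. exact: nth_map_ord. Qed.

Lemma degreeE (x : 'I_n) : arr s0 1 (x + 1) - arr s0 1 x = size (adj x).
Proof.
have lt_x := ltn_ord x.
rewrite addn1 /= /offset_array !(nth_map 0) ?size_iota ?nth_iota //; try lia.
rewrite add0n add1n (take_nth 0) /=; last by rewrite size_map size_enum_ord.
by rewrite sumn_rcons addKn nth_map_ord.
Qed.

(** The offset of [x] is the total length of the earlier lists, so the cell read is the flat index
    of [nth_flatten]. *)
Lemma neighbourE (x : 'I_n) k :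
  k < size (adj x) -> arr s0 2 (arr s0 1 x + k) = nth x (adj x) k.
Proof.
move=> lt_k; have lt_x := ltn_ord x.
have -> : arr s0 1 x = sumn (take x (shape [seq adj y | y <- enum 'I_n])).
  rewrite /= /offset_array (nth_map 0) ?size_iota ?nth_iota //; try lia.
  by rewrite add0n /shape -map_comp.
rewrite /= /neighbour_array map_flatten nth_flatten.
have -> : shape [seq [seq val y | y <- s] | s <- [seq adj y | y <- enum 'I_n]] =
    shape [seq adj y | y <- enum 'I_n].
  by rewrite /shape -map_comp; apply: eq_map => s /=; rewrite size_map.
rewrite -/(flatten_index _ x k) flatten_indexKl ?flatten_indexKr.
- by rewrite -map_comp nth_map_ord (nth_map x).
- by rewrite /shape -map_comp nth_map_ord.
by rewrite /shape -map_comp nth_map_ord.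
Qed.

Definition input_kept (s : state) : Prop :=
  forall b i, b < 3 -> arr s b i = arr s0 b i.

Lemma runs_rank s :
    reg s 0 = n -> reg s 2 = n -> input_kept s ->
  runs (countdown 2 rank_body) s (10 * n + 2)
    (fun s' => [/\ reg s' 0 = n, input_kept s' &
                   forall x, arr s' 4 (val x) = pos x]).
Proof.
move=> s_n s_k kept.
pose I k s' := [/\ reg s' 0 = n, reg s' 2 = k, input_kept s' &
  forall i : 'I_n, k <= i -> arr s' 4 (u i) = i].
apply: (runs_weaken (t1 := \sum_(i < n) (4 + 6) + 2) (Q1 := I 0)).
- by rewrite sum_nat_const card_ord; lia.
- move=> s' [? _ ? P]; split=> // x.
  by rewrite -[x in LHS](permKV u) P.
apply: (runs_countdown (I := I) (c := fun _ => 4)).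
- by move=> i s' [].
- move=> i s' lt_in [s'_n _ kept' P]; apply: runs_set_arr => //.
  split=> //= [b j lt_b|j le_ij].
    by rewrite -kept' // /set_arr /=; case: eqP => // b4; lia.
  have E : arr s' 0 i = u (Ordinal lt_in).
    by rewrite kept' // -(vertex_atE (Ordinal lt_in)).
  rewrite E; case: eqP => [/val_inj/perm_inj -> //|ne].
  apply: P; rewrite ltn_neqAle le_ij andbT.
  by apply/eqP => ij; apply: ne; congr (val (u _)); apply: val_inj.
by split=> // i; have := ltn_ord i; lia.
Qed.

Lemma runs_reach s :
    reg s 0 = n -> reg s 2 = n -> input_kept s ->
    (forall x, arr s 4 (val x) = pos x) ->
  runs (countdown 2 reach_body) s (\sum_x (36 * size (adj x) + 30) + 2)
    (fun s' => [/\ reg s' 0 = n, input_kept s' &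
       forall x, arr s' 5 (val x) = low_of (adj x) x
              /\ arr s' 6 (val x) = high_of (adj x) x]).
Proof.
move=> s_n s_k kept ranks.
pose ranked s' := [/\ reg s' 0 = n, input_kept s' & forall x, arr s' 4 (val x) = pos x].
pose done s' (l : seq 'I_n) x :=
  arr s' 5 (val x) = low_of l x /\ arr s' 6 (val x) = high_of l x.
pose I k s' := [/\ ranked s', reg s' 2 = k &
  forall x : 'I_n, k <= x -> done s' (adj x) x].
pose deg := nth 0 [seq size (adj x) | x <- enum 'I_n].
(* The three assignments take 16 units and the inner loop over [d] neighbours [31 * d + 2]; the
   budget rounds this up. *)
pose c k := 36 * deg k + 24.
apply: (runs_weaken (t1 := \sum_(i < n) (c i + 6) + 2) (Q1 := I 0)).
- by rewrite leq_add2r leq_sum // => x _; rewrite /c /deg nth_map_ord; lia.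
- by move=> s' [[? ? _] _ P]; split=> // x; apply: P.
apply: (runs_countdown (I := I) (c := c)); first by move=> i s' [].
  move=> i s' lt_in [[s'_n kept' ranks'] _ P].
  pose x := Ordinal lt_in.
  have -> : c i = 36 * size (adj x) + 24 by rewrite /c /deg -[i]/(val x) nth_map_ord.
  (* Inner invariant: the neighbours of index at least [k] have been folded into the two extremes of
     [x]. *)
  pose J k s1 := [/\ ranked s1, reg s1 2 = x, reg s1 3 = k,
    forall y : 'I_n, x < y -> done s1 (adj y) y & done s1 (drop k (adj x)) x].
  apply: (runs_seq (t1 := 4) (t2 := 36 * size (adj x) + 20)); first by lia.
  apply: runs_set_arr => //.
  apply: (runs_seq (t1 := 4) (t2 := 36 * size (adj x) + 16)); first by lia.
  apply: runs_set_arr => //.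
  apply: (runs_seq (t1 := 8) (t2 := 36 * size (adj x) + 8)); first by lia.
  apply: runs_set_reg => //.
  apply: (runs_weaken (t1 := \sum_(k < size (adj x)) (25 + 6) + 2) (Q1 := J 0)).
  - by rewrite sum_nat_const card_ord; lia.
  - move=> s1 [ranked1 reg1 _ P1 P2]; split=> // y le_iy.
    have [-> |ne_yx] := eqVneq y x; first by move: P2; rewrite drop0.
    by apply: P1; rewrite ltn_neqAle le_iy andbT -val_eqE eq_sym in ne_yx *.
  apply: (runs_countdown (I := J) (c := fun _ => 25)); first by move=> k s1 [].
    move=> k s1 lt_k [[s1_n kept1 ranks1] reg2 reg3 P1 [P2 P3]].
    set y := nth x (adj x) k.
    have dropE : drop k (adj x) = y :: drop k.+1 (adj x) by rewrite -drop_nth.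
    apply: (runs_seq (t1 := 7) (t2 := 18)) => //; apply: runs_set_reg => //.
    apply: (runs_seq (t1 := 9) (t2 := 9)) => //; apply: runs_set_arr => //.
    apply: runs_set_arr => //.
    set w := eval _ _.
    have wE : w = pos y.
      by rewrite /w /= reg2 (kept1 1) // (kept1 2) // neighbourE // ranks1.
    split=> //=.
    - split=> //= b j lt_b.
      by rewrite -kept1 //; move: b lt_b => [|[|[|]]].
    - move=> z lt_xz; rewrite /done /= reg2.
      have -> : (val z == val x) = false by exact: gtn_eqF.
      exact: P1.
    by rewrite /done /= reg2 eqxx /= P2 P3 dropE /= -wE; split; lia.
  split=> //=.
  - split=> //= b j lt_b.
    by rewrite -kept' //; move: b lt_b => [|[|[|]]].
  - by rewrite -[i]/(val x) -(degreeE x) -!kept' //.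
  - move=> z lt_xz; rewrite /done /=.
    have -> : (val z == i) = false by exact: gtn_eqF.
    exact: P.
  by rewrite /done /= eqxx /= drop_size -[i]/(val x) ranks'.
by split=> // x; have := ltn_ord x; lia.
Qed.

Lemma runs_select s :
    1 < n -> (forall i, i < n -> low_at i <= i) ->
    reg s 0 = 0 -> reg s 2 = n -> reg s 4 = n -> input_kept s ->
    (forall i, i < n -> arr s 5 (vertex_at i) = low_at i) ->
    (forall i, i < n -> arr s 6 (vertex_at i) = high_at i) ->
  runs (countdown 2 select_body) s (50 * n + 2)
    (fun s' => output s' = map vertex_at (chosen (greedy low_at high_at n n))).
Proof.
move=> n_gt1 low_le s_0 s_2 s_4 kept low_s high_s.
(* The output so far, followed by what the scan would still select from the current threshold, never
   changes. *)
pose I k s' := [/\ reg s' 2 = k, input_kept s',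
  forall i, i < n -> arr s' 5 (vertex_at i) = low_at i,
  forall i, i < n -> arr s' 6 (vertex_at i) = high_at i &
  output s' ++ map vertex_at (chosen (greedy low_at high_at k (reg s' 4))) =
  map vertex_at (chosen (greedy low_at high_at n n))].
apply: (runs_weaken (t1 := \sum_(i < n) (44 + 6) + 2) (Q1 := I 0)).
- by rewrite sum_nat_const card_ord; lia.
- by move=> s' [_ _ _ _ <-]; rewrite cats0.
apply: (runs_countdown (I := I) (c := fun _ => 44)); first by move=> i s' [].
  move=> i s' lt_in [_ kept' low' high' out].
  have vE j : arr s' 0 j = vertex_at j by rewrite kept'.
  apply: (runs_if (t1 := 36)) => //=.
    rewrite vE high' // => lt_ha.
    have lt_high : high_at i < reg s' 4 by lia.
    move: out; rewrite /= lt_high /=.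
    set b := maxn _ _ => out.
    have lt_bn : b < n by have := low_le i lt_in; lia.
    apply: (runs_seq (t1 := 4) (t2 := 32)) => //; apply: runs_set_reg => //=.
    apply: (runs_seq (t1 := 6) (t2 := 26)) => //; apply: runs_set_reg => //=.
    rewrite vE low' //.
    have -> : low_at i + (1 - low_at i) = b by lia.
    apply: (runs_seq (t1 := 5) (t2 := 21)) => //; apply: runs_set_reg => //=.
    rewrite vE low' //.
    apply: (runs_seq (t1 := 5) (t2 := 16)) => //; apply: runs_set_arr => //=.
    apply: (runs_seq (t1 := 8) (t2 := 8)) => //; apply: runs_set_arr => //=.
    apply: runs_set_reg => //=.
    rewrite !vE; split=> //=.
    - move=> b' j lt_b; rewrite -kept' //.
      by move: b' lt_b => [|[|[|]]].
    (* The two cells written are at or past the old length, so the earlier output is intact. *)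
    rewrite -out /output /= addn2 !mkseqS /= eqxx !addn1 eqxx /=.
    rewrite (ltn_eqF (ltnSn _)) !cat_rcons; congr (_ ++ _).
    rewrite /mkseq; apply/eq_in_map => j; rewrite mem_iota => lt_j.
    by rewrite !ifN //; apply/eqP; lia.
  rewrite vE high' // => le_ah; apply: runs_skip => //; split=> //=.
  by rewrite -out /=; case: ltnP => //; lia.
by split=> //; rewrite /output s_0 s_4.
Qed.

End Program.

(** * Extremes of closed neighbourhoods, and the umbrella property of intervals *)

Lemma low_ofP n (u : {perm 'I_n}) s x :
  [/\ forall y, y \in x :: s -> low_of u s x <= (u^-1%g y : 'I_n)
    & exists2 y, y \in x :: s & low_of u s x = (u^-1%g y : 'I_n)].
Proof.
elim: s => [|z s [le_s [y ys eq_y]]] /=.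
  by split=> [y|]; [rewrite inE => /eqP ->|exists x; rewrite ?inE].
split=> [w|].
  rewrite !inE geq_min orbCA => /orP[/eqP ->|ws]; first by rewrite leqnn.
  by rewrite (le_s w) ?orbT // inE.
rewrite eq_y; case: leqP => _; first by exists z; rewrite // !inE eqxx orbT.
by exists y => //; move: ys; rewrite !inE => /orP[|] ->; rewrite ?orbT.
Qed.

Lemma high_ofP n (u : {perm 'I_n}) s x :
  [/\ forall y, y \in x :: s -> (u^-1%g y : 'I_n) <= high_of u s x
    & exists2 y, y \in x :: s & high_of u s x = (u^-1%g y : 'I_n)].
Proof.
elim: s => [|z s [le_s [y ys eq_y]]] /=.
  by split=> [y|]; [rewrite inE => /eqP ->|exists x; rewrite ?inE].
split=> [w|].
  rewrite !inE leq_max orbCA => /orP[/eqP ->|ws]; first by rewrite leqnn.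
  by rewrite (le_s w) ?orbT // inE.
rewrite eq_y; case: leqP => _; last by exists z; rewrite // !inE eqxx orbT.
by exists y => //; move: ys; rewrite !inE => /orP[|] ->; rewrite ?orbT.
Qed.

(** Take [z] common to the outer intervals and [w] in the middle one, which is nonempty because
    [u j] has a neighbour. The smaller of [z] and [w] lies in both [J (u i)] and [J (u j)]: the
    order of left bounds controls its left side, the larger point its right side. *)
Lemma interval_umbrella (R : realType) n (e : rel 'I_n) (J : 'I_n -> interval R)
    (u : {perm 'I_n}) :
    simple_graph e -> no_isolated_vertex e -> interval_representation e J ->
    increasing_left_endpoints J u ->
  forall i j k : 'I_n, i < j -> j < k -> e (u i) (u k) -> e (u i) (u j).
Proof.
move=> [sym_e irr_e] iso rep incr i j k lt_ij lt_jk eik.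
have edge_neq x y : e x y -> x != y by apply: contraTneq => ->; rewrite irr_e.
have neq_ij : u i != u j by rewrite (inj_eq perm_inj) -val_eqE ltn_eqF.
have [z [zi zk]] := (rep _ _ (edge_neq _ _ eik)).1 eik.
have [y ejy] := iso (u j).
have [w [wj _]] := (rep _ _ (edge_neq _ _ ejy)).1 ejy.
apply/(rep _ _ neq_ij); move: zi zk wj.
move: (incr j k (ltnW lt_jk)) (incr i j (ltnW lt_ij)).
case: (J (u i)) => li ri; case: (J (u j)) => lj rj; case: (J (u k)) => lk rk.
move=> /= ljk lij; rewrite !itv_boundlr.
move=> /andP[li_z z_ri] /andP[lk_z _] /andP[lj_w w_rj].
case: (leP w z) => [le_wz|/ltW le_zw].
  exists w; rewrite !itv_boundlr lj_w w_rj (le_trans lij lj_w) /=; split=> //.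
  by apply: le_trans z_ri; rewrite bnd_simp.
exists z; rewrite !itv_boundlr li_z z_ri (le_trans ljk lk_z) /=; split=> //.
by apply: le_trans w_rj; rewrite bnd_simp.
Qed.

(** * The linear-time algorithm *)

Theorem theorem3p6 :
  exists (p : cmd) (c : nat),
    forall (R : realType) (n : nat) (e : rel 'I_n) (J : 'I_n -> interval R)
           (u : {perm 'I_n}) (adj : 'I_n -> seq 'I_n),
      simple_graph e ->
      connected_graph e ->
      no_isolated_vertex e ->
      interval_representation e J ->
      increasing_left_endpoints J u ->
      adjacency_lists e adj ->
      exists (t : nat) (s : state) (S : {set 'I_n}),
        [/\ exec p (input e u adj) t s,
            t <= c * (#|edges e| + n),
            perm_eq (output s) [seq val x | x <- enum S]
          & minimum_paired_dominating e S].
Proof.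
(* With [m] edges the budgets total at most [72 * m + 90 * n + 16], and [n > 1] absorbs the
   constant. *)
exists greedy_program, 200 => R n e J u adj simple_e conn_e iso_e rep incr adjP.
have umb := interval_umbrella simple_e iso_e rep incr.
pose F := low_at u adj; pose G := high_at u adj.
have FE (i : 'I_n) : F i = low_of u (adj (u i)) (u i) by apply: nth_map_ord.
have GE (i : 'I_n) : G i = high_of u (adj (u i)) (u i) by apply: nth_map_ord.
have closed_nbr i j : nbr_eq e u i j = (u j \in u i :: adj (u i)).
  by rewrite inE (proj2 (adjP (u i))) (inj_eq perm_inj) eq_sym.
have F_le i j : nbr_eq e u i j -> F i <= j.
  rewrite closed_nbr FE => ij; have [/(_ _ ij) + _] := low_ofP u (adj (u i)) (u i).
  by rewrite permK.
have G_ge (i j : 'I_n) : nbr_eq e u i j -> j <= G i.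
  rewrite closed_nbr GE => ij; have [/(_ _ ij) + _] := high_ofP u (adj (u i)) (u i).
  by rewrite permK.
have F_ex (i : 'I_n) : exists2 j : 'I_n, nbr_eq e u i j & F i = j.
  have [_ [y yi ey]] := low_ofP u (adj (u i)) (u i).
  by exists (u^-1%g y); rewrite ?FE // closed_nbr permKV.
have G_ex (i : 'I_n) : exists2 j : 'I_n, nbr_eq e u i j & G i = j.
  have [_ [y yi ey]] := high_ofP u (adj (u i)) (u i).
  by exists (u^-1%g y); rewrite ?GE // closed_nbr permKV.
have n_gt1 := order_gt1 simple_e conn_e iso_e.
have degs := sum_degree_le simple_e adjP.
pose l := chosen (greedy F G n n).
have lt_l : {in l, forall x, x < n}.
  exact: (chosen_lt simple_e conn_e iso_e umb F_le F_ex G_ge G_ex).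
have Ul : uniq l.
  apply: (@greedy_uniq n) => //.
  - exact: (reach_bound G_ge G_ex).
  - exact: (first_bound simple_e F_le F_ex G_ge).
  - exact: (first_lt simple_e conn_e umb F_le G_ge G_ex).
pose S := [set u i | i : 'I_n & val i \in l].
have minS : minimum_paired_dominating e S.
  apply: (greedy_minimum simple_e conn_e iso_e umb F_le F_ex G_ge G_ex) => i.
  by rewrite mem_imset ?inE //; apply: perm_inj.
have run : runs greedy_program (input e u adj) (200 * (#|edges e| + n))
    (fun s => output s = map (vertex_at u) l).
  pose D := \sum_x (36 * size (adj x) + 30) + 2.
  (* The 72 is 36 per list entry, with at most two entries per edge. *)
  have le_D : D <= 72 * #|edges e| + 30 * n + 2.
    have -> : D = 36 * (\sum_x size (adj x)) + n * 30 + 2.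
      by rewrite /D big_split /= sum_nat_const card_ord big_distrr.
    by move: degs; set d := bigop _ _ _; set m := #|_|; lia.
  apply: (runs_seq (t1 := 2) (t2 := (10 * n + 2) + (2 + (D + (6 + (50 * n + 2)))))).
    lia.
  apply: runs_set_reg => //.
  apply: (runs_seq (t1 := 10 * n + 2) (t2 := 2 + (D + (6 + (50 * n + 2))))) => //.
  apply: runs_weaken (leqnn _) _ (@runs_rank n e u adj _ _ _ _) => //.
  move=> s1 [s1n kept1 rank1].
  apply: (runs_seq (t1 := 2) (t2 := D + (6 + (50 * n + 2)))) => //.
  apply: runs_set_reg => //.
  apply: (runs_seq (t1 := D) (t2 := 6 + (50 * n + 2))) => //.
  apply: runs_weaken (leqnn _) _ (@runs_reach n e u adj _ _ _ _ _) => //.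
  move=> s2 [s2n kept2 scan2].
  apply: (runs_seq (t1 := 2) (t2 := 4 + (50 * n + 2))); first by lia.
  apply: runs_set_reg => //.
  apply: (runs_seq (t1 := 2) (t2 := 2 + (50 * n + 2))); first by lia.
  apply: runs_set_reg => //.
  apply: (runs_seq (t1 := 2) (t2 := 50 * n + 2)) => //.
  apply: runs_set_reg => //.
  apply: (@runs_select n e u adj) => //= i lt_in.
  - by rewrite -[i]/(val (Ordinal lt_in)) F_le // /nbr_eq eqxx.
  - by rewrite -[i]/(val (Ordinal lt_in)) vertex_atE (scan2 _).1 -FE.
  - by rewrite -[i]/(val (Ordinal lt_in)) vertex_atE (scan2 _).2 -GE.
have [t [s [ex le_t out]]] := run.
exists t, s, S; split=> //; rewrite out; apply: uniq_perm.
- rewrite map_inj_in_uniq // => i j /lt_l lti /lt_l ltj.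
  rewrite -[i]/(val (Ordinal lti)) -[j]/(val (Ordinal ltj)) !vertex_atE.
  by move=> /val_inj/perm_inj ->.
- by rewrite map_inj_uniq ?enum_uniq //; apply: val_inj.
move=> y; apply/mapP/mapP => [[i il ->]|[x]].
  exists (u (Ordinal (lt_l _ il))); last exact: (vertex_atE u (Ordinal (lt_l _ il))).
  by rewrite mem_enum; apply: imset_f; rewrite inE.
rewrite mem_enum => /imsetP [i]; rewrite inE => il -> ->.
by exists (val i); rewrite // vertex_atE.
Qed.
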